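(* Let $G$ be an $N$-free ordered group of finite width with identity $e$, and write its canonical chain $\mathcal V(G)=\{H_1,\dots,H_r\}$, together with $H_0=\{e\}$, as $$\{e\}=H_0<H_1<\cdots<H_r=G.$$ Let $K\le G$ be a subgroup with the induced order, and put $K_i:=K\cap H_i$ for $0\le i\le r$. Then $$|\mathcal V(K)|\le|\mathcal V(G)|,$$ with the convention $\mathcal V(\{e\})=\varnothing$, and $$\operatorname{width}(K)=\prod_{\substack{1\le i\le r\\ H_i/H_{i-1}\text{ of type }\mathbf A}}[K_i:K_{i-1}].$$ Consequently, $\operatorname{width}(K)\mid\operatorname{width}(G)$. More generally, if $L\triangleleft K$ is a normal subgroup of $K$ that is a module of the induced order on $K$, then $$\operatorname{width}(K/L)\mid\operatorname{width}(K)\mid\operatorname{width}(G).$$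
   Context: An ordered group is a group $G$ (identity $e$) equipped with a partial order $\le$ such that $x\le y$ implies $axb\le ayb$ for all $a,b,x,y\in G$. A poset is $N$-free if it has no four distinct elements $a,b,c,d$ whose only strict comparabilities among themselves are $a<b$, $c<b$, $c<d$. The width of a poset is the maximum size of an antichain. A module of a poset $X$ is a subset $M$ such that for every $x\in X\setminus M$ and $m,m'\in M$: $x\le m\iff x\le m'$ and $m\le x\iff m'\le x$. A nonempty module $M$ is strong if every module is disjoint from $M$, contained in $M$, or contains $M$. $S_G(x,y)$ is the least strong module of the poset $G$ containing $x$ and $y$. The canonical chain is $\mathcal V(G):=\{S_G(e,g):g\ne e\}$. It is known that $\mathcal V(G)$ is a chain under inclusion of convex subgroups; for $N$-free $G$ of finite width it is finite with largest member $G$ (if $G$ is nontrivial), every $H_i$ is normal in $G$, and each $H_i/H_{i-1}$, with the quotient order ($\alpha\le\beta$ iff $a\le b$ for some $a\in\alpha$, $b\in\beta$), is totally ordered (type $\mathbf C$) or finite and equality-ordered, i.e. its order is equality (type $\mathbf A$). A module is convex, so $K/L$ is an ordered group under the quotient order. An empty product is $1$. *)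

(* Defs.v *)
From HB Require Import structures.
From mathcomp Require Import all_boot all_order finmap.
From mathcomp Require Import mathcomp_extra boolp classical_sets functions cardinality.

Set Implicit Arguments.
Unset Strict Implicit.
Unset Printing Implicit Defensive.

Local Open Scope classical_set_scope.

HB.mixin Record isOrderedGroup (disp : Order.disp_t) G
    of Group G & Order.POrder disp G := {
  mulg_le2 : forall a b x y : G, (x <= y)%O -> (a * x * b <= a * y * b)%O%g
}.

#[short(type="orderedGroupType")]
HB.structure Definition OrderedGroup (disp : Order.disp_t) :=
  { G of Group G & Order.POrder disp G & isOrderedGroup disp G }.

(** A poset is a relation [le : T -> T -> Prop] together with a carrier
    [X : set T], so that induced orders on subsets and quotient orders on sets
    of cosets are treated alike. *)
Section Width.
Variables (T : Type) (le : T -> T -> Prop) (X : set T).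

Definition antichain (A : set T) :=
  A `<=` X /\ forall x y, A x -> A y -> le x y -> x = y.

Definition has_width (n : nat) :=
  (exists2 A, antichain A & (A #= `I_n)%card) /\
  (forall A, antichain A -> (A #<= `I_n)%card).

Definition finite_width := exists n, has_width n.

(* Equals 0 when antichains have unbounded size or one of them is infinite. *)
Definition width : nat := xget 0 has_width.

End Width.

Section Modules.
Variables (disp : Order.disp_t) (T : porderType disp) (X : set T).

(* The listed conditions force [a], [b], [c], [d] to be distinct. *)
Definition N_free := ~ exists a b c d : T,
  [/\ X a, X b, X c & X d] /\
  [/\ (a < b)%O, (c < b)%O & (c < d)%O] /\
  [/\ (a >< c)%O, (a >< d)%O & (b >< d)%O].

Definition is_module (M : set T) := M `<=` X /\
  forall x m m', X x -> ~ M x -> M m -> M m' ->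
    ((x <= m)%O <-> (x <= m')%O) /\ ((m <= x)%O <-> (m' <= x)%O).

Definition strong_module (M : set T) :=
  [/\ is_module M, M !=set0 &
      forall N, is_module N -> [\/ N `&` M = set0, N `<=` M | M `<=` N]].

(* An intersection of strong modules; [least_strong_moduleP] shows that it is
   the least one when [x] and [y] belong to [X]. *)
Definition least_strong_module (x y : T) : set T :=
  smallest strong_module [set x; y].

Lemma least_strong_moduleP x y : X x -> X y ->
  [/\ strong_module (least_strong_module x y),
      [set x; y] `<=` least_strong_module x y &
      forall M, strong_module M -> [set x; y] `<=` M ->
        least_strong_module x y `<=` M].
Proof.
move=> Xx Xy.
have sX : strong_module X.
  split; [by split | by exists x |].
  by move=> N [NX _]; apply: Or32.
have xyX : [set x; y] `<=` X by move=> z [] ->.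
have sub M : strong_module M -> [set x; y] `<=` M ->
    least_strong_module x y `<=` M.
  by move=> sM xyM z; apply.
have xyS : [set x; y] `<=` least_strong_module x y by move=> z xyz M [_]; apply.
split=> //; split.
- split; first exact: sub.
  move=> z m m' Xz nSz Sm Sm'.
  have [M [sM xyM] nMz] : exists2 M,
      strong_module M /\ [set x; y] `<=` M & ~ M z.
    apply: contrapT => nex; apply: nSz => M MP.
    by apply: contrapT => nMz; apply: nex; exists M.
  have [[_ modM] _ _] := sM.
  by apply: modM => //; apply: (sub M).
- by exists x; apply: xyS; left.
- move=> N modN.
  have [NI|/eqP/set0P[z [Nz Sz]]] := pselect (N `&` least_strong_module x y =
    set0).
    exact: Or31.
  have [NS|nNS] := pselect (N `<=` least_strong_module x y); first exact: Or32.
  apply: Or33; have [M [sM xyM] nNM] : exists2 M,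
      strong_module M /\ [set x; y] `<=` M & ~ N `<=` M.
    apply: contrapT => nex; apply: nNS => u Nu M MP.
    by apply: contrapT => nMu; apply: nex; exists M => // /(_ _ Nu).
  apply: (subset_trans (sub M sM xyM)).
  have [_ _ strM] := sM; have [NM0|/nNM//|//] := strM N modN.
  by have : (N `&` M) z by [split=> //; exact: (sub M) Sz]; rewrite NM0.
Qed.

End Modules.

Section OrderedGroups.
Variables (disp : Order.disp_t) (G : orderedGroupType disp).
Implicit Types H K L : set G.

Definition ord_le (x y : G) : Prop := (x <= y)%O.

Definition subgroup K := group_closed (mem K).

Definition normal_subgroup K L :=
  [/\ subgroup L, L `<=` K & forall k l, K k -> L l -> L (l ^ k)%g].

(* The canonical chain of [K], the subgroup [K] carrying the induced order. *)
Definition canonical_chain K : set (set G) :=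
  [set least_strong_module K 1%g g | g in K `\ 1%g].

Definition enumerates_canonical_chain (r : nat) (H : nat -> set G) :=
  [/\ H 0 = [set 1%g], H r = [set: G],
      (forall i, i < r -> H i `<` H i.+1) &
      canonical_chain [set: G] = [set H i | i in [set i | 1 <= i <= r]]].

Definition cosets K L : set (set G) :=
  [set [set (x * y)%g | y in L] | x in K].

Definition quotient_le (A B : set G) : Prop :=
  exists a b, [/\ A a, B b & ord_le a b].

(* Equals 0 when there are infinitely many cosets. *)
Definition group_index K L : nat := #|` fset_set (cosets K L)|%fset.

Definition type_A K L :=
  finite_set (cosets K L) /\
  forall A B, cosets K L A -> cosets K L B -> (quotient_le A B <-> A = B).

End OrderedGroups.

Arguments ord_le {disp G} x y.
Arguments quotient_le {disp G} A B.

(* Main.v *)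
Require Import Defs.
From HB Require Import structures.
From mathcomp Require Import all_boot all_order finmap.
From mathcomp Require Import mathcomp_extra boolp classical_sets functions cardinality.

(** If [x] and [y] are incomparable in an [N]-free poset, the least strong
    module containing them has no element comparable to both: with [N] the set
    of such elements of the whole poset, the elements outside [N] that are
    comparable to all of [N] form a strong module. Comparability of distinct
    cosets is therefore transitive in a layer [H_i / H_(i-1)] that contains two
    incomparable cosets. Its components are strong modules, so the layer is a
    chain or an antichain.

    Translations and conjugations are order automorphisms and must preserve the
    members of a finite chain, so every [H_i] is a normal subgroup. For a
    subgroup [K], each [K_i] is a lexicographic sum, indexed by
    [K_i / K_(i-1)], of copies of [K_(i-1)]: widths multiply, and the width of a
    layer of [K] is its index if the layer is an antichain and [1] if it is a
    chain. Finally, the least strong module of [K] containing [1] and [k]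
    depends only on the least [i] with [k] in [H_i]. *)

Set Implicit Arguments.
Unset Strict Implicit.
Unset Printing Implicit Defensive.

Import Order.TTheory.
Local Open Scope classical_set_scope.

(** * N-free posets *)

Section Posets.
Variables (disp : Order.disp_t) (T : porderType disp).
Implicit Types (X M N : set T).

Lemma strong_module_comparable X M N : strong_module X M -> strong_module X N ->
  M `&` N !=set0 -> M `<=` N \/ N `<=` M.
Proof.
move=> [mM _ _] [_ _ sN] [z [Mz Nz]].
have [NM0|MN|NM] := sN M mM; [|by left|by right].
by have : (M `&` N) z by []; rewrite NM0.
Qed.

Lemma module_setI X Y M : is_module X M -> Y `<=` X -> is_module Y (Y `&` M).
Proof.
move=> [MX modM] YX; split=> [z []//|z m m' Yz nz [_ Mm] [_ Mm']].
by apply: modM => // [|Mz]; [exact: YX | exact: nz].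
Qed.

Lemma module_comparable X M x m m' : is_module X M -> X x -> ~ M x ->
  M m -> M m' -> (x >=< m)%O -> (x >=< m')%O.
Proof.
move=> [_ modM] Xx nMx Mm Mm'; have [le ge] := modM x m m' Xx nMx Mm Mm'.
by rewrite /Order.comparable => /orP[/le->//|/ge->]; rewrite orbT.
Qed.

Lemma module_incomparable X M x m m' : is_module X M -> X x -> ~ M x ->
  M m -> M m' -> (x >< m)%O -> (x >< m')%O.
Proof.
move=> modM Xx nMx Mm Mm'; apply: contra.
exact: (module_comparable modM Xx nMx Mm' Mm).
Qed.

Section NFree.
Hypothesis Nfree : N_free [set: T].

(* A path [w - m - n - x] of comparabilities without shortcuts alternates
   between up and down steps, hence is an N. *)
Lemma N_free_no_P4 (w m n x : T) : (w >=< m)%O -> (m >=< n)%O -> (n >=< x)%O ->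
  (w >< n)%O -> (w >< x)%O -> (m >< x)%O -> False.
Proof.
move=> wm mn nx wn wx mx; apply: Nfree.
have neq (a b c : T) : (a >< c)%O -> (b >=< c)%O -> a != b.
  by move=> ac bc; apply: contraNneq ac => ->.
have [xm nw xw] : [/\ (x >< m)%O, (n >< w)%O & (x >< w)%O].
  by split; rewrite comparable_sym.
case/orP: (wm) => wm'.
- have nm' : (n <= m)%O.
    case/orP: mn => // mn; move: wn.
    by rewrite /Order.comparable (le_trans wm' mn).
  have nx' : (n <= x)%O.
    case/orP: nx => // xn'; move: mx.
    by rewrite /Order.comparable (le_trans xn' nm') orbT.
  exists w, m, n, x; split=> //; split=> //; split.
  + by rewrite lt_neqAle wm' (neq _ _ n).
  + by rewrite lt_neqAle nm' (neq _ _ w) // comparable_sym.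
  + by rewrite lt_neqAle nx' eq_sym (neq _ _ m) // comparable_sym.
- have mn' : (m <= n)%O.
    case/orP: mn => // nm'; move: wn.
    by rewrite /Order.comparable (le_trans nm' wm') orbT.
  have xn' : (x <= n)%O.
    case/orP: nx => // nx'; move: mx.
    by rewrite /Order.comparable (le_trans mn' nx').
  exists x, n, m, w; split=> //; split=> //; split.
  + by rewrite lt_neqAle xn' (neq _ _ m) // comparable_sym.
  + by rewrite lt_neqAle mn' (neq _ _ x) // comparable_sym.
  + by rewrite lt_neqAle wm' eq_sym (neq _ _ n).
Qed.

Definition common_comparables (x y : T) : set T :=
  [set n | (n >=< x)%O /\ (n >=< y)%O].

(** For incomparable [x] and [y], an explicit strong module around them; the least one is given only
    as an intersection. *)
Definition parallel_hull (x y : T) : set T :=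
  [set z | ~ common_comparables x y z /\
           forall n, common_comparables x y n -> (z >=< n)%O].

(** If [z] misses a common comparable [n], then comparability of [z] to [x] or [y] would give a
    forbidden path [z - x - n - y] or [z - y - n - x]. *)
Lemma parallel_hull_out x y z : (x >< y)%O -> ~ parallel_hull x y z ->
  common_comparables x y z \/ (forall m, parallel_hull x y m -> (z >< m)%O) /\
    exists2 n, common_comparables x y n & (z >< n)%O.
Proof.
move=> xy nMz; have [Nz|nNz] := pselect (common_comparables x y z); first by left.
right; have [n Nn zn] : exists2 n, common_comparables x y n & (z >< n)%O.
  apply: contrapT => nex; apply: nMz; split=> // n Nn.
  by apply: contrapT => /negP zn; apply: nex; exists n.
split; last by exists n.
have [nx ny] := Nn.
have [xn yn] : (x >=< n)%O /\ (y >=< n)%O by split; rewrite comparable_sym.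
have yx : (y >< x)%O by rewrite comparable_sym.
have zx : (z >< x)%O.
  apply/negP => zx; have zy : (z >< y)%O by apply/negP => zy; apply: nNz.
  exact: (N_free_no_P4 zx xn ny).
have zy : (z >< y)%O.
  by apply/negP => zy; exact: (N_free_no_P4 zy yn nx).
(* As [m] is no common comparable, it is incomparable to [x] or to [y]; that element ends a
   forbidden path [z - m - n - x] or [z - m - n - y]. *)
move=> m [nNm /(_ n Nn) mn]; apply/negP => zm.
have [mx|/negP mx] := pselect (m >=< x)%O; last first.
  exact: (N_free_no_P4 zm mn nx).
have [my|/negP my] := pselect (m >=< y)%O; first exact: nNm.
exact: (N_free_no_P4 zm mn ny).
Qed.

(** [x] and [y] lie on the same side of [z], as they would otherwise be comparable. So does [m]:
    from the other side it would be comparable to both through [z] and be a common comparable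
    itself. *)
Lemma parallel_hull_common x y z m : (x >< y)%O ->
  common_comparables x y z -> parallel_hull x y m ->
  ((z <= m)%O <-> (z <= x)%O) /\ ((m <= z)%O <-> (x <= z)%O).
Proof.
move=> xy [zx zy] [nNm /(_ z (conj zx zy)) mz].
have yx : (y >< x)%O by rewrite comparable_sym.
case/orP: (zx) => [zlx|xlz].
  have zly : (z <= y)%O.
    case/orP: zy => // yz; move: yx.
    by rewrite /Order.comparable (le_trans yz zlx).
  have nmz : ~ (m <= z)%O.
    move=> mlz; apply: nNm; split; rewrite /Order.comparable.
      by rewrite (le_trans mlz zlx).
    by rewrite (le_trans mlz zly).
  have nxz : ~ (x <= z)%O.
    by move=> xz; move: xy; rewrite /Order.comparable (le_trans xz zly).
  by split; split=> // _; case/orP: mz.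
have ylz : (y <= z)%O.
  case/orP: zy => // zy'; move: xy.
  by rewrite /Order.comparable (le_trans xlz zy').
have nzm : ~ (z <= m)%O.
  move=> zm; apply: nNm; split; rewrite /Order.comparable.
    by rewrite (le_trans xlz zm) orbT.
  by rewrite (le_trans ylz zm) orbT.
have nzx : ~ (z <= x)%O.
  by move=> zx'; move: yx; rewrite /Order.comparable (le_trans ylz zx').
by split; split=> // _; case/orP: mz.
Qed.

Lemma parallel_hullP x y : (x >< y)%O ->
  parallel_hull x y x /\ parallel_hull x y y.
Proof.
move=> xy; split; split=> [[]|n [] nx ny].
- by rewrite (negPf xy).
- by rewrite comparable_sym.
- by rewrite comparable_sym (negPf xy).
- by rewrite comparable_sym.
Qed.

Lemma strong_parallel_hull x y : (x >< y)%O ->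
  strong_module [set: T] (parallel_hull x y).
Proof.
move=> xy; have [Mx My] := parallel_hullP xy.
have modM : is_module [set: T] (parallel_hull x y).
  split=> // z m m' _ nMz Mm Mm'.
  have [Nz|[inc _]] := parallel_hull_out xy nMz.
    have [lem gem] := parallel_hull_common xy Nz Mm.
    have [lem' gem'] := parallel_hull_common xy Nz Mm'.
    by split; [rewrite lem lem'|rewrite gem gem'].
  move: (inc _ Mm) (inc _ Mm'); rewrite /Order.comparable !negb_or.
  by move=> /andP[/negPf-> /negPf->] /andP[/negPf-> /negPf->].
split=> //; first by exists x.
move=> A modA.
have [|/eqP/set0P[b [Ab Mb]]] := pselect (A `&` parallel_hull x y = set0).
  exact: Or31.
have [|/existsNP[a /not_implyP[Aa nMa]]] := pselect (A `<=` parallel_hull x y).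
  exact: Or32.
apply: Or33 => m Mm; apply: contrapT => nAm.
have [Na|[inc [n Nn an]]] := parallel_hull_out xy nMa.
  have cmp z z' : parallel_hull x y z -> parallel_hull x y z' ->
      A z -> ~ A z' -> (z >=< z')%O.
    move=> Mz Mz' Az nAz'; rewrite comparable_sym.
    apply: (module_comparable modA _ nAz' Aa Az) => //.
    by have [_ /(_ a Na)] := Mz'.
  (* Every element of the hull is incomparable to [x] or to [y], which are
     incomparable, so no proper part of it is comparable to all the rest. *)
  have same z z' : parallel_hull x y z -> parallel_hull x y z' ->
      (z >< z')%O -> A z -> A z'.
    move=> Mz Mz' zz' Az; apply: contrapT => nAz'.
    by move: zz'; rewrite (cmp z z').
  have yx : (y >< x)%O by rewrite comparable_sym.
  have inx z : parallel_hull x y z -> (z >< x)%O \/ (z >< y)%O.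
    move=> [nNz _]; apply: contrapT => /not_orP[/negP/negPn zx /negP/negPn zy].
    exact: nNz.
  have Ax : A x.
    by have [bx|by_] := inx b Mb; [|have Ay := same b y Mb My by_ Ab];
      [exact: (same b x)|exact: (same y x)].
  have Ay : A y by exact: (same x y).
  have [mx|my] := inx m Mm; apply: nAm.
    by apply: (same x m) => //; rewrite comparable_sym.
  by apply: (same y m) => //; rewrite comparable_sym.
(* Now [a] is incomparable to [n], while [m] and [b] are comparable to it. If [n] is in [A], then
   [m] is comparable to [n], hence to [a]; if not, [n] is comparable to [b], hence to [a]. *)
have mn : (m >=< n)%O by have [_ /(_ n Nn)] := Mm.
have bn : (b >=< n)%O by have [_ /(_ n Nn)] := Mb.
have [An|nAn] := pselect (A n).
  move: (inc m Mm); rewrite comparable_sym.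
  by rewrite (module_comparable modA _ nAm An Aa).
move: an; rewrite comparable_sym (module_comparable modA _ nAn Ab Aa) //.
by rewrite comparable_sym.
Qed.

Lemma least_strong_module_common x y n : (x >< y)%O ->
  common_comparables x y n -> ~ least_strong_module [set: T] x y n.
Proof.
move=> xy Nn Sn; have [Mx My] := parallel_hullP xy.
have /(_ n)[//|//] : least_strong_module [set: T] x y `<=` parallel_hull x y.
have [_ _] := least_strong_moduleP (I : [set: T] x) (I : [set: T] y).
by apply; [exact: strong_parallel_hull | move=> z [] ->].
Qed.

End NFree.
End Posets.

(** * Canonical chain of an ordered group *)

Section Automorphisms.
Variables (disp : Order.disp_t) (T : porderType disp).
Implicit Types M : set T.

Lemma strong_module_preimage (f g : T -> T) M :
  cancel f g -> cancel g f -> {mono f : x y / (x <= y)%O} ->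
  strong_module [set: T] M -> strong_module [set: T] (f @^-1` M).
Proof.
move=> fK gK fmono.
have modP (f' : T -> T) N : {mono f' : x y / (x <= y)%O} ->
    is_module [set: T] N -> is_module [set: T] (f' @^-1` N).
  move=> f'mono [_ modN]; split=> // z m m' _ nNz Nm Nm'.
  by rewrite -!(f'mono z) -!(f'mono _ z); exact: modN.
move=> [modM [m Mm] sM]; split; first exact: modP.
  by exists (g m); rewrite /= gK.
move=> N modN.
have gmono : {mono g : x y / (x <= y)%O}.
  by move=> x y; rewrite -{2}(gK x) -{2}(gK y) fmono.
have [NM0|NM|MN] := sM _ (modP g N gmono modN).
- apply/Or31/seteqP; split=> // z [Nz Mz].
  have : (g @^-1` N `&` M) (f z) by split=> //=; rewrite fK.
  by rewrite NM0.
- by apply: Or32 => z Nz; apply: NM; rewrite /= fK.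
- by apply: Or33 => z /MN /=; rewrite fK.
Qed.

Lemma least_strong_module_preimage (f g : T -> T) x y :
  cancel f g -> cancel g f -> {mono f : x y / (x <= y)%O} ->
  f @^-1` least_strong_module [set: T] (f x) (f y) =
  least_strong_module [set: T] x y.
Proof.
move=> fK gK fmono.
have gmono : {mono g : x y / (x <= y)%O}.
  by move=> u v; rewrite -{2}(gK u) -{2}(gK v) fmono.
have [sS Sxy minS] := least_strong_moduleP (I : [set: T] x) (I : [set: T] y).
have [sS' Sxy' minS'] :=
  least_strong_moduleP (I : [set: T] (f x)) (I : [set: T] (f y)).
apply/seteqP; split; last first.
  apply: minS; first exact: strong_module_preimage sS'.
  by move=> z [] ->; apply: Sxy'; [left|right].
have sub : least_strong_module [set: T] (f x) (f y) `<=`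
    g @^-1` least_strong_module [set: T] x y.
  apply: minS'; first exact: strong_module_preimage sS.
  by move=> z [] -> /=; rewrite fK; apply: Sxy; [left|right].
by move=> z /sub /=; rewrite fK.
Qed.

End Automorphisms.

Section OrderedGroup.
Variables (disp : Order.disp_t) (G : orderedGroupType disp).
Local Open Scope group_scope.

Lemma lemgl (a : G) : {mono *%g a : x y / (x <= y)%O}.
Proof.
move=> x y; apply/idP/idP => [/(mulg_le2 a^-1 1)|/(mulg_le2 a 1)].
  by rewrite !mulg1 !mulKg.
by rewrite !mulg1.
Qed.

Lemma lemgr (a : G) : {mono *%g^~ a : x y / (x <= y)%O}.
Proof.
move=> x y; apply/idP/idP => [/(mulg_le2 1 a^-1)|/(mulg_le2 1 a)].
  by rewrite !mul1g !mulgK.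
by rewrite !mul1g.
Qed.

Lemma le_conjg (a : G) : {mono conjg^~ a : x y / (x <= y)%O}.
Proof. by move=> x y; rewrite !conjgE lemgl lemgr. Qed.

Lemma comparable_mulgl (a x y : G) : (a * x >=< a * y)%O = (x >=< y)%O.
Proof. by rewrite /Order.comparable !lemgl. Qed.

Lemma subgroupP (K : set G) : subgroup K <->
  [/\ K 1, forall x, K x -> K x^-1 & forall x y, K x -> K y -> K (x * y)].
Proof.
split=> [sK|[K1 KV KM]].
  split=> [|x Kx|x y Kx Ky].
  - by have [/set_mem] := sK.
  - exact/set_mem/(group_closedV sK)/mem_set.
  - by apply: set_mem; apply: (group_closedM sK); exact: mem_set.
split=> [|x y /set_mem Kx /set_mem Ky]; apply: mem_set => //.
exact/KM/KV.
Qed.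

Lemma subgroupI (K L : set G) :
  subgroup K -> subgroup L -> subgroup (K `&` L).
Proof.
move=> /subgroupP[K1 KV KM] /subgroupP[L1 LV LM]; apply/subgroupP; split.
- by [].
- by move=> x [Kx Lx]; split; [apply: KV|apply: LV].
- by move=> x y [Kx Lx] [Ky Ly]; split; [apply: KM|apply: LM].
Qed.

(** * Invariance of the canonical chain under order automorphisms *)

Section Chain.
Variables (r : nat) (H : nat -> set G).
Hypothesis H_chain : enumerates_canonical_chain r H.

Let H0 : H 0 = [set 1]. Proof. by case: H_chain. Qed.

Lemma chain_subset i j : i <= j -> j <= r -> H i `<=` H j.
Proof.
have [_ _ Hlt _] := H_chain.
move=> /subnK <-; elim: (j - i) => [|n IH] nr; first by [].
exact: (subset_trans (IH (ltnW nr)) (properW (Hlt _ nr))).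
Qed.

Lemma chain_proper i j : i < j -> j <= r -> ~ (H j `<=` H i).
Proof.
have [_ _ Hlt _] := H_chain.
move=> ij jr HH; have [_] := Hlt i (leq_trans ij jr).
by apply; exact: (subset_trans (chain_subset ij jr)).
Qed.

Lemma chain_generated i : 0 < i <= r ->
  exists2 g, g != 1 & H i = least_strong_module [set: G] 1 g.
Proof.
move=> ir; have [_ _ _ HV] := H_chain.
have : canonical_chain [set: G] (H i) by rewrite HV; exists i.
by move=> [g [_ /eqP g1] <-]; exists g.
Qed.

Lemma chain_least_strong g : g != 1 ->
  exists2 i, 0 < i <= r & least_strong_module [set: G] 1 g = H i.
Proof.
move=> /eqP g1; have [_ _ _ HV] := H_chain.
have : canonical_chain [set: G] (least_strong_module [set: G] 1 g) by exists g.
by rewrite HV => -[i ir <-]; exists i.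
Qed.

Lemma chain_strong i : i <= r -> strong_module [set: G] (H i).
Proof.
case: i => [_|i ir]; last first.
  have [g _ ->] := chain_generated (ir : 0 < i.+1 <= r).
  by have [] := least_strong_moduleP (I : [set: G] 1) (I : [set: G] g).
rewrite H0; split; first by split=> // z m m' _ _ -> ->.
  by exists 1.
move=> N _; have [N1|nN1] := pselect (N 1); first by apply: Or33 => z ->.
by apply/Or31/seteqP; split=> // z [Nz /= z1]; apply: nN1; rewrite -z1.
Qed.

Lemma chain1 i : i <= r -> H i 1.
Proof. by move=> ir; apply: (@chain_subset 0) => //; rewrite H0. Qed.

(** Meant for preimages of chain members under automorphisms, whose two generators may both differ
    from [1]. The module contains the chain members at which [x] and [y] appear; these are nested,
    and the larger one contains both elements. *)
Lemma chain_least_strong2 x y : x != y ->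
  least_strong_module [set: G] x y 1 ->
  exists2 i, 0 < i <= r & least_strong_module [set: G] x y = H i.
Proof.
move=> xy S1; have ST z : [set: G] z by [].
have [sS Sxy minS] := least_strong_moduleP (ST x) (ST y).
have level z : exists2 i, i <= r &
    [/\ H i z, H i `<=` least_strong_module [set: G] 1 z & (z != 1 -> 0 < i)].
  have [->|z1] := eqVneq z 1.
    exists 0 => //; split=> //; rewrite H0// => t ->.
    by have [_ + _] := least_strong_moduleP (ST 1) (ST 1); apply; left.
  have [i ir eS] := chain_least_strong z1; exists i; first by case/andP: ir.
  have [_ Sz _] := least_strong_moduleP (ST 1) (ST z).
  by rewrite -eS; split=> // [|_]; [apply: Sz; right|case/andP: ir].
have [i ir [Hx iS ix]] := level x.
have [j jr [Hy jS jy]] := level y.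
have m0 : 0 < maxn i j.
  rewrite leq_max; have [x1|/ix->//] := eqVneq x 1.
  by rewrite jy ?orbT// -x1 eq_sym.
have mr : maxn i j <= r by rewrite geq_max ir.
exists (maxn i j); first by rewrite m0.
apply/seteqP; split.
  apply: minS; first exact: chain_strong.
  move=> z [] ->.
    exact: (chain_subset (leq_maxl _ _)).
  exact: (chain_subset (leq_maxr _ _)).
have sub z : least_strong_module [set: G] x y z ->
    least_strong_module [set: G] 1 z `<=` least_strong_module [set: G] x y.
  have [_ _ minz] := least_strong_moduleP (ST 1) (ST z).
  by move=> Sz; apply: minz => // t [] ->.
rewrite /maxn; case: ltnP => _.
  by apply: (subset_trans jS); apply: sub; apply: Sxy; right.
by apply: (subset_trans iS); apply: sub; apply: Sxy; left.
Qed.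

(* If [H i] were mapped to a larger [H j], then [H j] would also be expanded,
   so induction on [r - i] applies. *)
Lemma chain_expanding f g i : cancel f g -> cancel g f ->
  {mono f : x y / (x <= y)%O} -> i <= r -> 0 < i -> H i `<=` f @^-1` H i ->
  f @^-1` H i = H i.
Proof.
move=> fK gK fmono; have [n] := ubnP (r - i).
elim: n i => // n IH i nri ir i0 Hsub.
have [h h1 Hi] : exists2 h, h != 1 & H i = least_strong_module [set: G] 1 h.
  by apply: chain_generated; rewrite i0.
have gh : g 1 != g h by rewrite (can_eq gK) eq_sym.
have pre : f @^-1` H i = least_strong_module [set: G] (g 1) (g h).
  by rewrite -(least_strong_module_preimage _ _ fK gK fmono) !gK Hi.
have [|j /andP[j0 jr] eS] := chain_least_strong2 gh.
  by rewrite -pre; apply: Hsub; exact: chain1.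
have preH : f @^-1` H i = H j by rewrite pre.
case: (ltngtP i j) => ij; last by rewrite preH ij.
- have preHj : f @^-1` H j = H j.
    apply: IH => //.
      by rewrite -ltnS (leq_trans _ nri)// ltnS ltn_sub2l// (leq_trans ij).
    by rewrite -preH => z; exact: Hsub.
  (* [H i] and [H j] now have the same preimage under the bijection [f], so they are equal. *)
  case: (chain_proper ij jr) => z Hz; rewrite -(gK z) -[H i _]/((f @^-1` H i) _).
  by rewrite preH -preHj /= gK.
- by case: (chain_proper ij ir); rewrite -preH.
Qed.

(** The preimage is a strong module meeting [H i], so one contains the other, and [f] or its inverse
    [g] expands [H i]. The trivial [H 0] is treated apart, since [chain_expanding] concerns positive
    indices. *)
Lemma chain_invariant f g i : cancel f g -> cancel g f ->
  {mono f : x y / (x <= y)%O} -> i <= r ->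
  (f @^-1` H i `&` H i) !=set0 -> f @^-1` H i = H i.
Proof.
move=> fK gK fmono ir meets; have [i0|] := posnP i.
  move: meets; rewrite i0 H0 => -[z [/= fz z1]].
  have f1 : f 1 = 1 by rewrite z1 in fz.
  apply/seteqP; split=> t /= t1; last by rewrite t1; exact: f1.
  by apply: (can_inj fK); exact: (etrans t1 (esym f1)).
move=> i0; have sH := chain_strong ir.
have [sub|sub] :=
    strong_module_comparable (strong_module_preimage fK gK fmono sH) sH meets.
  have gmono : {mono g : x y / (x <= y)%O}.
    by move=> u v; rewrite -{2}(gK u) -{2}(gK v) fmono.
  have subg : H i `<=` g @^-1` H i by move=> z; rewrite -{1}(gK z) => /sub.
  rewrite -{1}(chain_expanding gK fK gmono ir i0 subg).
  by apply/seteqP; split=> z /=; rewrite fK.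
exact: (chain_expanding fK gK fmono).
Qed.

(** Left translation by [h] in [H i] maps [1] to [h]; hence the preimage of [H i] meets [H i] and
    equals it. *)
Lemma chain_subgroup i : i <= r -> subgroup (H i).
Proof.
move=> ir; have H1 := chain1 ir.
have inv h : H i h -> *%g h @^-1` H i = H i.
  move=> Hh; apply: (chain_invariant (mulKg h) (mulVKg h) (@lemgl h) ir).
  by exists 1; rewrite /= mulg1.
have HV h : H i h -> H i h^-1.
  by move=> Hh; rewrite -(inv h Hh) /= mulgV.
by apply/subgroupP; split=> // x y Hx; rewrite -{1}(inv x Hx).
Qed.

Lemma chain_conj i k z : i <= r -> H i z -> H i (z ^ k).
Proof.
move=> ir; rewrite -{1}(chain_invariant (conjgK k) (conjgKV k) (@le_conjg k) ir)//.
by exists 1; rewrite /= conj1g; split; exact: chain1.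
Qed.

Lemma chain_level i h : i < r -> H i.+1 h -> ~ H i h ->
  least_strong_module [set: G] 1 h = H i.+1.
Proof.
move=> ir Hh nHh; have ST z : [set: G] z by [].
have h1 : h != 1 by apply/eqP => h1; apply: nHh; rewrite h1; exact/chain1/ltnW.
have [k /andP[k0 kr] eS] := chain_least_strong h1.
have [_ Sh minS] := least_strong_moduleP (ST 1) (ST h).
case: (ltngtP k i.+1) => ki; last by rewrite -ki.
  by case: nHh; apply: (@chain_subset k i ki (ltnW ir)); rewrite -eS; apply: Sh; right.
case: (chain_proper ki kr); rewrite -eS; apply: minS; first exact: chain_strong.
by move=> z [] ->//; exact: chain1.
Qed.

(** Translation by [x^-1] carries the pair to [1] and [x^-1 * y], whose least strong module is
    [H i.+1]. This subgroup contains [x^-1], so the translation maps it into itself. *)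
Lemma chain_least_strong_sub i x y : i < r -> H i.+1 x -> H i.+1 y ->
  ~ H i (x^-1 * y) -> H i.+1 `<=` least_strong_module [set: G] x y.
Proof.
move=> ir Hx Hy nHxy; have /subgroupP[_ HV HM] := chain_subgroup ir.
rewrite -(least_strong_module_preimage _ _ (mulKg x^-1) (mulVKg x^-1) (@lemgl x^-1)).
rewrite mulVg (@chain_level i)//; last by apply: HM => //; exact: HV.
by move=> z Hz /=; apply: HM => //; exact: HV.
Qed.

End Chain.

(** * Dichotomy for a layer: chain or antichain *)

Section Dichotomy.
Variables (H L : set G).
Hypotheses (Nfree : N_free [set: G]) (sH : subgroup H) (sL : subgroup L).
Hypotheses (strH : strong_module [set: G] H) (strL : strong_module [set: G] L).
Hypothesis consecutive : forall x y, H x -> H y -> ~ L (x^-1 * y) ->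
  H `<=` least_strong_module [set: G] x y.

Lemma no_common_comparable x y n : H x -> H y -> H n -> ~ L (x^-1 * y) ->
  (x >< y)%O -> (n >=< x)%O -> (n >=< y)%O -> False.
Proof.
move=> Hx Hy Hn nLxy xy nx ny.
apply: (least_strong_module_common Nfree xy (conj nx ny)).
exact: consecutive Hn.
Qed.

(** The component of the trivial coset in the comparability graph of the layer [H / L]. By
    [no_common_comparable], comparability of different cosets is transitive, so a coset and its
    neighbours make up a component. *)
Let C := [set z | H z /\ (L z \/ (z >=< 1)%O)].

(** If both elements avoid [L], then [1] would be a common comparable of an incomparable pair. If
    one of them lies in [L], the module [L] turns comparability of the other with [1] into
    comparability with it. *)
Lemma component_comparable b c : C b -> C c -> ~ L (b^-1 * c) -> (b >=< c)%O.
Proof.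
have /subgroupP[L1 LV LM] := sL; have /subgroupP[H1 HV HM] := sH.
have [modL _ _] := strL.
move=> [Hb cb] [Hc cc] nL; apply/negPn/negP => bc.
have Lcmp z l : ~ L z -> L l -> (z >=< 1)%O -> (z >=< l)%O.
  by move=> nLz Ll; apply: (module_comparable modL).
have [Lb|nLb] := pselect (L b).
  have nLc : ~ L c by move=> Lc; apply: nL; apply: LM => //; apply: LV.
  move/negP: bc; apply; rewrite comparable_sym.
  by apply: Lcmp => //; case: cc.
have b1 : (b >=< 1)%O by case: cb.
have [Lc|nLc] := pselect (L c); first by move/negP: bc; apply; exact: Lcmp.
have c1 : (c >=< 1)%O by case: cc.
by apply: (no_common_comparable Hb Hc H1 nL bc); rewrite comparable_sym.
Qed.

Lemma component_incomparable w z : H w -> ~ C w -> C z -> (w >< z)%O.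
Proof.
have /subgroupP[L1 LV LM] := sL; have /subgroupP[H1 HV HM] := sH.
have [modL _ _] := strL.
move=> Hw nCw [Hz cz].
have nLw : ~ L w by move=> Lw; apply: nCw; split=> //; left.
have w1 : (w >< 1)%O by apply/negP => w1; apply: nCw; split=> //; right.
have [Lz|nLz] := pselect (L z); first exact: (module_incomparable modL _ nLw L1).
apply/negP => wz; have z1 : (z >=< 1)%O by case: cz.
apply: (@no_common_comparable 1 w z) => //.
- by rewrite invg1 mul1g.
- by rewrite comparable_sym.
- by rewrite comparable_sym.
Qed.

(** Because of [v], [C] is more than one coset. If a module [A] meets [C] and leaves it at [a],
    which is incomparable to all of [C], then the parts of [C] inside and outside [A] are mutually
    incomparable. If both were nonempty, [component_comparable] would put all of [C] into a single
    coset. *)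
Lemma strong_component v : H v -> ~ L v -> (v >=< 1)%O -> strong_module [set: G] C.
Proof.
move=> Hv nLv v1.
have /subgroupP[L1 LV LM] := sL; have /subgroupP[H1 HV HM] := sH.
have [modH _ _] := strH.
have C1 : C 1 by split=> //; left.
have Cv : C v by split=> //; right.
split; [split=> // w m m' _ nCw Cm Cm'|by exists 1|move=> A modA].
  have [Hw|nHw] := pselect (H w); last first.
    have [_ modH'] := modH; have [[Hm _] [Hm' _]] := (Cm, Cm').
    exact: modH'.
  move: (component_incomparable Hw nCw Cm) (component_incomparable Hw nCw Cm').
  rewrite /Order.comparable !negb_or.
  by move=> /andP[/negPf-> /negPf->] /andP[/negPf-> /negPf->].
have [|/eqP/set0P[b [Ab Cb]]] := pselect (A `&` C = set0); first exact: Or31.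
have [|/existsNP[a /not_implyP[Aa nCa]]] := pselect (A `<=` C); first exact: Or32.
apply: Or33 => c Cc; apply: contrapT => nAc.
(* [H] is strong and contains [c], which is not in [A]; so [A] lies inside [H], and
   [component_incomparable] applies to [a]. *)
have AH : A `<=` H.
  have [_ _ /(_ A modA)[AH0|//|HA]] := strH; last first.
    by case: nAc; apply: HA; case: Cc.
  by have : (A `&` H) b by [split=> //; case: Cb]; rewrite AH0.
have near t : C t -> L (b^-1 * t).
  have inc x y : A x -> ~ A y -> C y -> (x >< y)%O.
    move=> Ax nAy Cy; rewrite comparable_sym.
    apply: (module_incomparable modA _ nAy Aa Ax) => //; rewrite comparable_sym.
    exact: component_incomparable (AH _ Aa) nCa Cy.
  have same x y : A x -> ~ A y -> C x -> C y -> L (x^-1 * y).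
    move=> Ax nAy Cx Cy; apply: contrapT => /(component_comparable Cx Cy).
    by apply/negP; exact: inc.
  have Lbc := same b c Ab nAc Cb Cc.
  move=> Ct; have [At|nAt] := pselect (A t); last exact: same.
  have := LM _ _ Lbc (LV _ (same t c At nAc Ct Cc)).
  by rewrite invgM invgK mulgA mulgK.
have := LM _ _ (LV _ (near 1 C1)) (near v Cv).
by rewrite mulg1 invgK mulVKg.
Qed.

(** Suppose different cosets contain a comparable pair [u], [v] and an incomparable pair [x], [y].
    The first makes [C] a strong module containing [1] and [u^-1 * v], so [C] contains [H]; the
    second puts [x^-1 * y] in [H] but outside [C]. *)
Lemma chain_or_antichain :
  (forall x y, H x -> H y -> ~ L (x^-1 * y) -> (x >=< y)%O) \/
  (forall x y, H x -> H y -> ~ L (x^-1 * y) -> (x >< y)%O).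
Proof.
have /subgroupP[H1 HV HM] := sH; have /subgroupP[L1 _ _] := sL.
have [|nchain] :=
    pselect (forall x y, H x -> H y -> ~ L (x^-1 * y) -> (x >=< y)%O).
  by left.
right=> u v Hu Hv nLuv; apply/negP => uv; apply: nchain => x y Hx Hy nLxy.
apply/negPn/negP => xy.
have Huv : H (u^-1 * v) by apply: HM => //; exact: HV.
have uv1 : (u^-1 * v >=< 1)%O.
  by rewrite comparable_sym -(comparable_mulgl u) mulg1 mulVKg.
have sC := strong_component Huv nLuv uv1.
have /consecutive : ~ L (1^-1 * (u^-1 * v)) by rewrite invg1 mul1g.
have Hxy : H (x^-1 * y) by apply: HM => //; exact: HV.
move=> /(_ H1 Huv _ Hxy).
have [_ _ minS] :=
  least_strong_moduleP (I : [set: G] 1) (I : [set: G] (u^-1 * v)).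
have CS : [set 1; u^-1 * v] `<=` C.
  by move=> z [] ->; [split=> //; left|split=> //; right].
move=> /(minS _ sC CS)[_ [//|]].
by apply/negP; rewrite -(comparable_mulgl x) mulg1 mulVKg comparable_sym.
Qed.

End Dichotomy.

End OrderedGroup.

(** * Width and cosets *)

Lemma card_le_inj T U (A : set T) (B : set U) (f : T -> U) :
  {in A &, injective f} -> (forall x, A x -> B (f x)) -> (A #<= B)%card.
Proof.
move=> finj fAB; rewrite -(card_le_eql (inj_card_eq finj)).
by apply: subset_card_le => _ [x /fAB ? <-].
Qed.

Lemma card_leX T U (A : set T) (B : set U) m n :
  (A #<= `I_m)%card -> (B #<= `I_n)%card -> (A `*` B #<= `I_(m * n))%card.
Proof.
move=> /pcard_leP[f] /pcard_leP[g].
have fm a : A a -> f a < m by move=> Aa; exact: ('funS_f Aa).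
have gn b : B b -> g b < n by move=> Bb; exact: ('funS_g Bb).
have divE a b : B b -> (f a * n + g b) %/ n = f a.
  move=> /gn gb; rewrite divnMDl ?divn_small ?addn0//.
  exact: leq_ltn_trans gb.
have modE a b : B b -> (f a * n + g b) %% n = g b.
  by move=> /gn gb; rewrite modnMDl modn_small.
apply: (@card_le_inj _ _ _ _ (fun p => f p.1 * n + g p.2)); last first.
  move=> p [/fm fp /gn gp] /=.
  apply: (@leq_trans ((f p.1).+1 * n)); first by rewrite mulSn addnC ltn_add2r.
  by rewrite leq_mul2r fp orbT.
move=> [a b] [a' b'] /set_mem[/= Aa Bb] /set_mem[/= Aa' Bb'] e.
have ea : f a = f a' by rewrite -(divE a b Bb) e divE.
have eb : g b = g b' by rewrite -(modE a b Bb) e modE.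
by congr pair; [apply: ('inj_f _ _ ea)|apply: ('inj_g _ _ eb)]; exact: mem_set.
Qed.

Lemma card_geX T U (A : set T) (B : set U) m n :
  (`I_m #<= A)%card -> (`I_n #<= B)%card -> (`I_(m * n) #<= A `*` B)%card.
Proof.
(* [pcard_leP] needs a pointed codomain. Over an empty type the hypothesis forces [m = 0], and next
   [n = 0]. *)
elim/Ppointed: T A => T A.
  rewrite [A]empty_eq0 card_le0 => /eqP/(congr1 (fun X => X 0)) /=.
  case: m => [_|m]; first by move=> _; rewrite mul0n II0; exact: card_ge0.
  by rewrite /= propeqE => -[/(_ isT)].
elim/Ppointed: U B => U B Am.
  rewrite [B]empty_eq0 card_le0 => /eqP/(congr1 (fun X => X 0)) /=.
  case: n => [_|n]; first by rewrite muln0 II0; exact: card_ge0.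
  by rewrite /= propeqE => -[/(_ isT)].
move: Am => /pcard_leP[f] /pcard_leP[g].
apply: (@card_le_inj _ _ _ _ (fun k => (f (k %/ n), g (k %% n)))).
  move=> k l /set_mem/= km /set_mem/= lm [].
  have n0 : 0 < n by move: km; case: n {g lm} => //; rewrite muln0.
  have dm j : j < m * n -> j %/ n \in `I_m.
    by move=> jm; apply/mem_set; rewrite /= ltn_divLR.
  have rn j : j %% n \in `I_n by apply/mem_set; rewrite /= ltn_mod.
  move=> /('inj_f (dm _ km) (dm _ lm)) ed /('inj_g (rn _) (rn _)) er.
  by rewrite (divn_eq k n) ed er -divn_eq.
move=> k /= km; have n0 : 0 < n by move: km; case: n {g} => //; rewrite muln0.
split=> /=; first by apply: 'funS_f; rewrite /= ltn_divLR.
by apply: 'funS_g; rewrite /= ltn_mod.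
Qed.

Lemma card_eqX T U (A : set T) (B : set U) m n :
  (A #= `I_m)%card -> (B #= `I_n)%card -> (A `*` B #= `I_(m * n))%card.
Proof.
move=> /card_eqPle[Am mA] /card_eqPle[Bn nB].
by apply/card_eqPle; split; [exact: card_leX|exact: card_geX].
Qed.

Section WidthTheory.
Variables (T : Type) (le : T -> T -> Prop).
Implicit Types X : set T.

Lemma width_unique X m n : has_width le X m -> has_width le X n -> m = n.
Proof.
move=> [[A aA Am] leA] [[B aB Bn] leB]; apply/eqP.
rewrite eqn_leq -!card_le_II -(card_le_eql Am) -(card_le_eql Bn).
by rewrite leB// leA.
Qed.

Lemma has_width_width X n : has_width le X n -> width le X = n.
Proof.
by move=> wn; apply: xget_unique => // m wm; exact: width_unique wm wn.
Qed.

Lemma bounded_finite_width X n :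
  (forall A, antichain le X A -> (A #<= `I_n)%card) -> finite_width le X.
Proof.
move=> bd.
pose P k := `[< exists2 A, antichain le X A & (A #= `I_k)%card >].
have exP : exists k, P k.
  by exists 0; apply/asboolP; exists set0; [split|rewrite II0].
have ubP k : P k -> k <= n.
  by move=> /asboolP[A /bd An Ak]; rewrite -card_le_II -(card_le_eql Ak).
have [k /asboolP wk maxk] := ex_maxnP exP ubP.
exists k; split=> // A aA.
have /finite_setP[m Am] : finite_set A.
  by apply/finite_set_leP; exists n; exact: bd.
by rewrite (card_le_eql Am) card_le_II; apply: maxk; apply/asboolP; exists A.
Qed.

Lemma finite_widthS X Y : Y `<=` X -> finite_width le X -> finite_width le Y.
Proof.
move=> YX [n [_ bd]]; apply: (@bounded_finite_width _ n) => A [AY aA].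
by apply: bd; split=> //; exact: (subset_trans AY).
Qed.

End WidthTheory.

Section Cosets.
Variables (disp : Order.disp_t) (G : orderedGroupType disp).
Local Open Scope group_scope.
Implicit Types K L H P : set G.

Definition coset L (x : G) : set G := [set x * y | y in L].
(** The default [1] is reached only for the empty set, which is no coset of a subgroup. *)
Definition coset_repr (A : set G) : G := xget 1 A.

Lemma in_coset L x z : coset L x z <-> L (x^-1 * z).
Proof.
split=> [[y Ly <-]|Lz]; first by rewrite mulKg.
by exists (x^-1 * z) => //; rewrite mulVKg.
Qed.

Section Subgroup.
Variable L : set G.
Hypothesis sL : subgroup L.

Lemma coset_refl x : coset L x x.
Proof. by apply/in_coset; rewrite mulVg; have /subgroupP[] := sL. Qed.

Lemma coset_eqP x y : coset L x = coset L y <-> L (x^-1 * y).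
Proof.
have /subgroupP[L1 LV LM] := sL; split=> [e|Lxy].
  by apply/in_coset; rewrite e; exact: coset_refl.
apply/seteqP; split=> z /in_coset Lz; apply/in_coset.
  by have := LM _ _ (LV _ Lxy) Lz; rewrite invgM invgK -mulgA mulVKg.
by have := LM _ _ Lxy Lz; rewrite -mulgA mulVKg.
Qed.

Lemma coset_reprK K A : cosets K L A -> coset L (coset_repr A) = A.
Proof.
move=> [x Kx eA]; have : A (coset_repr A).
  by apply: xgetPex; exists x; rewrite -eA; exact: coset_refl.
by rewrite -{1}eA => /in_coset/coset_eqP <-.
Qed.

Lemma in_coset_repr K A : subgroup K -> L `<=` K -> cosets K L A ->
  K (coset_repr A).
Proof.
move=> /subgroupP[_ _ KM] LK cA; have [x Kx eA] := cA.
have : A (coset_repr A) by rewrite -{1}(coset_reprK cA); exact: coset_refl.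
by rewrite -{1}eA => -[y /LK Ky <-]; exact: KM.
Qed.

End Subgroup.

Section ModuleCosets.
Variables K L : set G.
Hypotheses (sK : subgroup K) (sL : subgroup L) (LK : L `<=` K).

Lemma quotient_le_coset x y : ord_le x y -> quotient_le (coset L x) (coset L y).
Proof. by move=> xy; exists x, y; split=> //; exact: coset_refl. Qed.

(** Comparable elements have comparable cosets. The lemma bounds the width of the quotient by that
    of [K]. *)
Lemma antichain_repr B : antichain quotient_le (cosets K L) B ->
  antichain ord_le K (coset_repr @` B) /\ (coset_repr @` B #= B)%card.
Proof.
move=> [BK aB]; split.
  split=> [_ [A /BK cA <-]|_ _ [A BA <-] [A' BA' <-] le]; first exact: (in_coset_repr sL).
  congr coset_repr; apply: aB => //.
  rewrite -(coset_reprK sL (BK _ BA)) -(coset_reprK sL (BK _ BA')).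
  exact: quotient_le_coset.
apply: inj_card_eq => A A' /set_mem BA /set_mem BA' e.
by rewrite -(coset_reprK sL (BK _ BA)) -(coset_reprK sL (BK _ BA')) e.
Qed.

Lemma finite_width_cosets : finite_width ord_le K ->
  finite_width quotient_le (cosets K L).
Proof.
move=> [n [_ bd]]; apply: (@bounded_finite_width _ _ _ n) => B /antichain_repr[aB eB].
by rewrite -(card_le_eql eB); exact: bd.
Qed.

Hypothesis modL : is_module K L.

Lemma coset_module x : K x -> is_module K (coset L x).
Proof.
have /subgroupP[_ KV KM] := sK; have [_ modL'] := modL.
move=> Kx; split=> [_ [y /LK Ky <-]|z m m' Kz nz /in_coset Lm /in_coset Lm'].
  exact: KM.
rewrite -!(lemgl x^-1 z) -!(lemgl x^-1 _ z); apply: modL' => //.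
  by apply: KM => //; exact: KV.
by move=> /in_coset.
Qed.

(** Different cosets are disjoint modules: in [a <= b], first [b] may be replaced by [y], then [a]
    by [x]. *)
Lemma quotient_leP x y : K x -> K y -> coset L x <> coset L y ->
  quotient_le (coset L x) (coset L y) -> ord_le x y.
Proof.
move=> Kx Ky nxy [a [b [xa yb ab]]].
have disj z : coset L x z -> ~ coset L y z.
  move=> /in_coset/(coset_eqP sL) xz /in_coset/(coset_eqP sL) yz.
  by apply: nxy; rewrite xz yz.
have [_ mody] := coset_module Ky; have [xK modx] := coset_module Kx.
have [le_a _] := mody a b y (xK _ xa) (disj _ xa) yb (coset_refl sL y).
have nyx : ~ coset L x y by move=> /disj; apply; exact: coset_refl.
have [_ le_x] := modx y a x Ky nyx xa (coset_refl sL x).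
exact/le_x/le_a.
Qed.

(* [K] is the lexicographic sum, indexed by [K/L], of copies of [L]. *)
Lemma has_width_module m n : has_width quotient_le (cosets K L) m ->
  has_width ord_le L n -> has_width ord_le K (m * n).
Proof.
have /subgroupP[K1 KV KM] := sK.
move=> [[B aB Bm] bdm] [[A0 [A0L aA0] A0n] bdn]; split.
- have [BK aB'] := aB.
  (* Lower bound: representatives of [m] incomparable cosets, each multiplied by the [n] elements of
     an antichain of [L]. *)
  pose f (p : set G * G) := coset_repr p.1 * p.2.
  have fcos p : (B `*` A0) p -> coset L (f p) = p.1.
    move=> [Bp Ap]; rewrite -[RHS](coset_reprK sL (BK _ Bp)); apply/esym.
    by apply/(coset_eqP sL); rewrite mulKg; exact: A0L.
  exists (f @` (B `*` A0)); last first.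
    rewrite (card_eql (inj_card_eq _)); first exact: card_eqX.
    move=> p q /set_mem Ap /set_mem Aq e.
    have e1 : p.1 = q.1 by rewrite -(fcos p Ap) -(fcos q Aq) e.
    have e2 : p.2 = q.2 by move: e; rewrite /f e1 => /mulgI.
    by case: p q e1 e2 {e Ap Aq} => [? ?] [? ?] /= -> ->.
  split=> [_ [p [Bp Ap] <-]|_ _ [p Dp <-] [q Dq <-] le].
    apply: KM; first exact: (in_coset_repr sL sK LK (BK _ Bp)).
    exact/LK/A0L.
  have [[Bp Ap] [Bq Aq]] := (Dp, Dq).
  have e1 : p.1 = q.1.
    apply: aB' => //; rewrite -(fcos p Dp) -(fcos q Dq).
    exact: quotient_le_coset.
  move: le; rewrite /f e1 /ord_le lemgl => le.
  by rewrite (aA0 _ _ Ap Aq le).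
(* Upper bound: the cosets met by [A] form an antichain, and the part of [A] in each of them is a
   translate of an antichain of [L], numbered below [n] by [g]. *)
move=> A [AK aA]; pose rep a := coset_repr (coset L a).
have cosK a : A a -> cosets K L (coset L a) by move=> /AK Ka; exists a.
have aA' : antichain quotient_le (cosets K L) (coset L @` A).
  split=> [_ [a Aa <-]|_ _ [a Aa <-] [b Ab <-] le]; first exact: cosK.
  apply: contrapT => ne; case: (ne); congr coset; apply: aA => //.
  by apply: quotient_leP => //; exact: AK.
have /choice[g gP] : forall x, exists g : G -> nat,
    {in [set l | L l /\ A (x * l)] &, injective g} /\
    forall l, L l -> A (x * l) -> g l < n.
  move=> x; have /bdn : antichain ord_le L [set l | L l /\ A (x * l)].
    split=> [l []//|l l' [_ Al] [_ Al'] le]; apply/(mulgI x)/aA => //.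
    by rewrite /ord_le lemgl.
  move=> /pcard_leP[g]; exists g; split; first exact: 'inj_g.
  by move=> l Ll Al; apply: 'funS_g.
have repL a : A a -> L ((rep a)^-1 * a).
  by move=> Aa; apply/(coset_eqP sL)/(coset_reprK sL)/cosK.
pose f a := (coset L a, g (rep a) ((rep a)^-1 * a)).
apply: (@card_le_trans _ _ _ ((coset L @` A) `*` `I_n)); last first.
  by apply: card_leX; [exact: bdm|exact: card_lexx].
apply: (@card_le_inj _ _ _ _ f) => [a b /set_mem Aa /set_mem Ab [e]|a Aa].
  have er : rep b = rep a by rewrite /rep e.
  rewrite er => eg; apply: (mulgI (rep a)^-1).
  have [ginj _] := gP (rep a); apply: ginj eg; apply/mem_set => /=.
    by rewrite mulVKg; split=> //; exact: repL.
  by rewrite -er mulVKg; split=> //; exact: repL.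
split; first by exists a.
by have [_] := gP (rep a); apply; rewrite ?mulVKg//; exact: repL.
Qed.

End ModuleCosets.
End Cosets.

(** * Layers of the chain and their subgroups *)

Section Quotients.
Variables (disp : Order.disp_t) (G : orderedGroupType disp).
Local Open Scope group_scope.
Implicit Types K L H P : set G.

(** Stated on elements rather than in the quotient order, so that it passes at once to the layers of
    a subgroup. *)
Definition chain_mod K L :=
  forall x y, K x -> K y -> ~ L (x^-1 * y) -> (x >=< y)%O.

Definition antichain_mod K L :=
  forall x y, K x -> K y -> ~ L (x^-1 * y) -> (x >< y)%O.

Section Widths.
Variables K L : set G.
Hypotheses (sK : subgroup K) (sL : subgroup L) (LK : L `<=` K).

Lemma chain_mod_width : chain_mod K L ->
  has_width quotient_le (cosets K L) 1.
Proof.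
have /subgroupP[K1 _ _] := sK; move=> ch; split.
  exists [set coset L 1]; last exact: card_set1.
  by split=> [_ ->|_ _ -> ->//]; exists 1.
move=> A [AK aA]; apply: (@card_le_inj _ _ _ _ (fun=> 0)) => //.
move=> X Y /set_mem AX /set_mem AY _.
have [[x Kx eX] [y Ky eY]] := (AK _ AX, AK _ AY).
apply: contrapT => nXY; have nL : ~ L (x^-1 * y).
  by move=> /(coset_eqP sL) e; apply: nXY; rewrite -eX -eY; exact: e.
have /orP[xy|yx] := ch x y Kx Ky nL; apply: nXY.
  by apply: aA => //; rewrite -eX -eY; exact: quotient_le_coset.
by apply/esym/aA => //; rewrite -eX -eY; exact: quotient_le_coset.
Qed.

Lemma antichain_mod_quotient_le X Y : antichain_mod K L ->
  cosets K L X -> cosets K L Y -> quotient_le X Y -> X = Y.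
Proof.
have /subgroupP[K1 KV KM] := sK.
move=> anti [x Kx <-] [y Ky <-] [a [b [xa yb ab]]].
have [Ka Kb] : K a /\ K b.
  by move: xa yb => [l /LK Kl <-] [l' /LK Kl' <-]; split; exact: KM.
have Lab : L (a^-1 * b).
  apply: contrapT => /(anti _ _ Ka Kb)/negP; apply.
  by rewrite /Order.comparable ab.
move: xa yb => /in_coset/(coset_eqP sL) xa /in_coset/(coset_eqP sL) yb.
by move/(coset_eqP sL): Lab; rewrite -xa -yb.
Qed.

Hypothesis fwK : finite_width ord_le K.

Lemma antichain_mod_antichain : antichain_mod K L ->
  antichain quotient_le (cosets K L) (cosets K L).
Proof. by move=> anti; split=> // X Y KX KY; exact: antichain_mod_quotient_le. Qed.

(** The cosets form one antichain, so the width of the quotient bounds their number. *)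
Lemma antichain_mod_finite : antichain_mod K L -> finite_set (cosets K L).
Proof.
move=> /antichain_mod_antichain aK; apply/finite_set_leP.
by have [n [_ bd]] := finite_width_cosets sK sL LK fwK; exists n; exact: bd.
Qed.

Lemma antichain_mod_width : antichain_mod K L ->
  has_width quotient_le (cosets K L) (group_index K L).
Proof.
move=> anti; have /finite_setP[n Kn] := antichain_mod_finite anti.
rewrite /group_index (card_fset_set Kn); split.
  by exists (cosets K L) => //; exact: antichain_mod_antichain.
by move=> A [AK _]; rewrite -(card_le_eqr Kn); exact: subset_card_le.
Qed.

Lemma antichain_mod_type_A : antichain_mod K L -> type_A K L.
Proof.
move=> anti; split=> [|X Y KX KY]; first exact: antichain_mod_finite.
split=> [|<-]; first exact: antichain_mod_quotient_le.
by have [x _ <-] := KX; apply: quotient_le_coset => //; exact: lexx.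
Qed.

(** A quotient both totally ordered and equality-ordered is trivial; hence no proper layer is a
    chain of type A. *)
Lemma chain_mod_type_A : chain_mod K L -> type_A K L -> K `<=` L.
Proof.
have /subgroupP[K1 _ _] := sK.
move=> ch [_ eqle] x Kx; apply: contrapT => nLx.
have nL : ~ L (1^-1 * x) by rewrite invg1 mul1g.
have [cK1 cKx] : cosets K L (coset L 1) /\ cosets K L (coset L x).
  by split; [exists 1|exists x].
case/orP: (ch 1 x K1 Kx nL) => le; apply: nL; apply/(coset_eqP sL).
  by apply/eqle => //; exact: quotient_le_coset.
by apply/esym/eqle => //; exact: quotient_le_coset.
Qed.

End Widths.

(** * Divisibility of indices *)

Section Index.
Variables H L P : set G.
Hypotheses (sH : subgroup H) (sL : subgroup L) (sP : subgroup P).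
Hypotheses (LH : L `<=` H) (PH : P `<=` H).
Hypothesis normL : forall p l, P p -> L l -> L (l ^ p).

Let M := [set p * l | p in P & l in L].

Lemma subgroup_product : subgroup M.
Proof.
have /subgroupP[P1 PV PM] := sP; have /subgroupP[L1 LV LM] := sL.
apply/subgroupP; split; first by exists 1 => //; exists 1; rewrite ?mulg1.
  move=> _ [p Pp [l Ll <-]]; exists p^-1; first exact: PV.
  exists (l^-1 ^ p^-1); first by apply: normL; [exact: PV|exact: LV].
  by rewrite invgM -conjgC.
move=> _ _ [p Pp [l Ll <-]] [q Pq [m Lm <-]].
exists (p * q); first exact: PM.
exists (l ^ q * m); first by apply: LM => //; exact: normL.
by rewrite mulgA -(mulgA p q) -conjgC !mulgA.
Qed.

(** With [M] the product of [P] and [L], one has $[H:L]=[H:M][P:P\cap L]$: multiplying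
    representatives gives a bijection from pairs of a coset of [M] in [H] and a coset of [P ∩ L] in
    [P] to the cosets of [L] in [H]. *)
Lemma index_dvd : finite_set (cosets H L) ->
  group_index P (P `&` L) %| group_index H L.
Proof.
have /subgroupP[P1 PV PM] := sP; have /subgroupP[L1 LV LM] := sL.
have /subgroupP[H1 HV HM] := sH.
have sM := subgroup_product; have /subgroupP[M1 MV MM] := sM.
have sPL := subgroupI sP sL.
have PLP : P `&` L `<=` P by move=> z [].
have MH : M `<=` H by move=> _ [p /PH Hp [l /LH Hl <-]]; exact: HM.
have LM' : L `<=` M by move=> l Ll; exists 1 => //; exists l => //; rewrite mul1g.
move=> finHL.
pose D := cosets H M `*` cosets P (P `&` L).
pose f (q : set G * set G) := coset L (coset_repr q.1 * coset_repr q.2).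
have fM q : D q -> coset M (coset_repr q.1 * coset_repr q.2) = q.1.
  move=> [Hq Pq]; rewrite -[RHS](coset_reprK sM Hq); apply/esym.
  apply/(coset_eqP sM); rewrite mulKg; exists (coset_repr q.2).
    exact: (in_coset_repr sPL sP PLP Pq).
  by exists 1; rewrite ?mulg1.
have finj : {in D &, injective f}.
  move=> p q /set_mem Dp /set_mem Dq e.
  have {}e : L ((coset_repr p.1 * coset_repr p.2)^-1 *
                (coset_repr q.1 * coset_repr q.2)) by exact/(coset_eqP sL).
  have e1 : p.1 = q.1.
    by rewrite -(fM p Dp) -(fM q Dq); apply/(coset_eqP sM)/LM'.
  have e2 : p.2 = q.2.
    have [[_ Pp] [_ Pq]] := (Dp, Dq).
    rewrite -(coset_reprK sPL Pp) -(coset_reprK sPL Pq); apply/(coset_eqP sPL).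
    split; last by move: e; rewrite e1 invgM -mulgA mulKg.
    apply: PM; last exact: (in_coset_repr sPL sP PLP Pq).
    by apply: PV; exact: (in_coset_repr sPL sP PLP Pp).
  by case: p q e1 e2 {e Dp Dq} => [? ?] [? ?] /= -> ->.
have fD : f @` D = cosets H L.
  apply/seteqP; split=> [_ [q [Hq Pq] <-]|_ [h Hh <-]].
    exists (coset_repr q.1 * coset_repr q.2) => //; apply: HM.
      exact: (in_coset_repr sM sH MH Hq).
    exact/PH/(in_coset_repr sPL sP PLP Pq).
  have cM : cosets H M (coset M h) by exists h.
  have [p Pp [l Ll ehl]] : M ((coset_repr (coset M h))^-1 * h).
    exact/(coset_eqP sM)/(coset_reprK sM cM).
  have cP : cosets P (P `&` L) (coset (P `&` L) p) by exists p.
  exists (coset M h, coset (P `&` L) p) => //=; rewrite /f /=.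
  apply/(coset_eqP sL); rewrite invgM -mulgA -ehl mulgA.
  apply: LM => //.
  by have [] : (P `&` L) ((coset_repr (coset (P `&` L) p))^-1 * p)
    by exact/(coset_eqP sPL)/(coset_reprK sPL cP).
have eqD := inj_card_eq finj; rewrite fD in eqD.
have finD : finite_set D by rewrite -(eq_finite_set eqD).
(* Each factor embeds in [D] with the trivial coset as other coordinate; so it is finite, and
   [group_index] is its true cardinality. *)
have cM : cosets H M (coset M 1) by exists 1.
have cP : cosets P (P `&` L) (coset (P `&` L) 1) by exists 1.
have /finite_setP[a Ha] : finite_set (cosets H M).
  apply: (@card_le_finite _ _ _ D) => //.
  apply: (@card_le_inj _ _ _ _ (fun X => (X, coset (P `&` L) 1))) => //.
  by move=> X Y _ _ [].
have /finite_setP[b Pb] : finite_set (cosets P (P `&` L)).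
  apply: (@card_le_finite _ _ _ D) => //.
  apply: (@card_le_inj _ _ _ _ (fun X => (coset M 1, X))) => //.
  by move=> X Y _ _ [].
have Hab : (cosets H L #= `I_(a * b))%card.
  by rewrite (card_eql eqD); exact: card_eqX.
by rewrite /group_index (card_fset_set Hab) (card_fset_set Pb) dvdn_mull.
Qed.

End Index.

(** * Strong modules of a subgroup and its layers *)

Section StrongModules.
Variables K H L M : set G.
Hypotheses (sK : subgroup K) (sH : subgroup H) (sL : subgroup L).
Hypotheses (LH : L `<=` H) (HK : H `<=` K).
Hypotheses (modH : is_module K H) (modL : is_module K L).
Hypothesis chain_anti : chain_mod H L \/ antichain_mod H L.
Hypothesis strM : strong_module K M.

Lemma module_inside N : N `<=` H ->
  (forall z m m', H z -> ~ N z -> N m -> N m' ->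
    ((z <= m)%O <-> (z <= m')%O) /\ ((m <= z)%O <-> (m' <= z)%O)) ->
  is_module K N.
Proof.
move=> NH modN; split=> [|z m m' Kz nNz Nm Nm']; first exact: (subset_trans NH).
have [Hz|nHz] := pselect (H z); first exact: modN.
by have [_] := modH; apply => //; exact: NH.
Qed.

Lemma module_coset_le x y z : H x -> H y -> H z -> ~ L (x^-1 * y) -> L (y^-1 * z) ->
  ((x <= y)%O <-> (x <= z)%O) /\ ((y <= x)%O <-> (z <= x)%O).
Proof.
move=> Hx Hy Hz nxy Lyz.
have [_] := coset_module sK (subset_trans LH HK) modL (HK Hy); apply.
- exact: HK.
- by move=> /in_coset/(coset_eqP sL) e; apply/nxy/(coset_eqP sL)/esym.
- exact: coset_refl.
- exact/in_coset.
Qed.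

(** An element of [H] outside this set lies in the coset of [v] or above [v], hence strictly above
    the whole set. *)
Lemma module_lower_segment v : chain_mod H L -> H v ->
  is_module K [set t | [/\ H t, (t <= v)%O & ~ L (v^-1 * t)]].
Proof.
move=> ch Hv; apply: module_inside => [t []//|s m m' Hs nAs].
suff below t : [/\ H t, (t <= v)%O & ~ L (v^-1 * t)] ->
    (t <= s)%O /\ ~ (s <= t)%O.
  by move=> /below[ms nsm] /below[ms' nsm'].
move=> [Ht tv nvt]; have vs : L (v^-1 * s) \/ (v <= s)%O.
  have [|nvs] := pselect (L (v^-1 * s)); first by left.
  have /orP[|sv] := ch v s Hv Hs nvs; first by right.
  by case: nAs.
have ntv : ~ L (t^-1 * v).
  by move=> /(coset_eqP sL) e; apply/nvt/(coset_eqP sL)/esym.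
have nvt' : ~ (v <= t)%O.
  move=> vt; apply: nvt; have -> : v = t by apply/le_anti; rewrite vt tv.
  by rewrite mulVg; have /subgroupP[] := sL.
case: vs => [vs|vs]; last first.
  by split; [exact: le_trans tv vs|move=> st; apply/nvt'/(le_trans vs st)].
have [[tvs _] [_ svt]] := module_coset_le Ht Hv Hs ntv vs.
by split; [exact: tvs|move=> /svt].
Qed.

Lemma module_upper_segment u : chain_mod H L -> H u ->
  is_module K [set t | [/\ H t, (u <= t)%O & ~ L (u^-1 * t)]].
Proof.
move=> ch Hu; apply: module_inside => [t []//|s m m' Hs nAs].
suff above t : [/\ H t, (u <= t)%O & ~ L (u^-1 * t)] ->
    (s <= t)%O /\ ~ (t <= s)%O.
  by move=> /above[ms nsm] /above[ms' nsm'].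
move=> [Ht ut nut]; have us : L (u^-1 * s) \/ (s <= u)%O.
  have [|nus] := pselect (L (u^-1 * s)); first by left.
  have /orP[su|] := ch u s Hu Hs nus; last by right.
  by case: nAs.
have ntu : ~ L (t^-1 * u).
  by move=> /(coset_eqP sL) e; apply/nut/(coset_eqP sL)/esym.
have ntu' : ~ (t <= u)%O.
  move=> tu; apply: nut; have -> : u = t by apply/le_anti; rewrite ut tu.
  by rewrite mulVg; have /subgroupP[] := sL.
case: us => [us|us]; last first.
  by split; [exact: le_trans us ut|move=> ts; apply/ntu'/(le_trans ts us)].
have [[_ tsu] [ust _]] := module_coset_le Ht Hu Hs ntu us.
by split; [exact: ust|move=> /tsu].
Qed.

(** A module that meets the strong module [M] without containing it lies in [M]; this is [sat].
    Around any [z] of [H] outside [M] such a module is found: a segment if the layer is a chain, a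
    union of two cosets if it is an antichain. *)
Lemma strong_module_level y : M 1 -> H y -> ~ L y -> M y -> H `<=` M.
Proof.
move=> M1 Hy nLy My.
have /subgroupP[L1 LV LM] := sL; have /subgroupP[H1 HV HM] := sH.
have [modM _ strM'] := strM.
have sat N : is_module K N -> (N `&` M) !=set0 -> ~ (M `<=` N) -> N `<=` M.
  move=> modN [t [Nt Mt]] nMN; have [NM0|//|//] := strM' N modN.
  by have : (N `&` M) t by []; rewrite NM0.
have [//|nHM] := pselect (H `<=` M).
have MH : M `<=` H.
  by apply: contrapT => nMH; apply: nHM; apply: sat => //; exists 1.
move=> z Hz; apply: contrapT => nMz.
(* A coset meeting [M] cannot contain both [1] and [y], so it lies in [M]; hence the coset of [z]
   avoids [M]. *)
have nMcoset t : M t -> ~ L (t^-1 * z).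
  move=> Mt /in_coset tz; apply: nMz; apply: sat tz.
  - exact: (coset_module sK (subset_trans LH HK) modL (HK (MH _ Mt))).
  - by exists t; split=> //; exact: coset_refl.
  move=> Mt'; apply: nLy; move: (Mt' 1 M1) (Mt' y My).
  move=> /in_coset/(coset_eqP sL) e /in_coset/(coset_eqP sL) e'.
  by rewrite -[y]mul1g -invg1; apply/(coset_eqP sL); rewrite -e -e'.
have nMcoset' t : M t -> ~ L (z^-1 * t).
  by move=> /nMcoset n /(coset_eqP sL) e; apply/n/(coset_eqP sL)/esym.
have symL a b : ~ L (a^-1 * b) -> ~ L (b^-1 * a).
  by move=> n /(coset_eqP sL) e; apply/n/(coset_eqP sL)/esym.
case: chain_anti => [ch|anti].
  (* Given such [u <= v]: if [z] is below [v], the lower segment of [v] contains [z] and [u] but not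
     [v]; if above, the upper segment of [u] contains [z] and [v] but not [u]. *)
  have nle u v : M u -> M v -> ~ L (u^-1 * v) -> ~ (u <= v)%O.
    move=> Mu Mv nuv uv; have [Hu Hv] := (MH _ Mu, MH _ Mv).
    apply: nMz; have /orP[zv|vz] := ch z v Hz Hv (nMcoset' v Mv).
      apply: (sat _ (module_lower_segment ch Hv)).
      - by exists u; split=> //; split=> //; exact: symL.
      - by move=> /(_ v Mv)[_ _]; rewrite mulVg.
      - by split=> //; exact: nMcoset.
    apply: (sat _ (module_upper_segment ch Hu)).
    - by exists v.
    - by move=> /(_ u Mu)[_ _]; rewrite mulVg.
    - by split=> //; [exact: le_trans uv vz|exact: nMcoset].
  have n1y : ~ L (1^-1 * y) by rewrite invg1 mul1g.
  by have /orP[|] := ch 1 y H1 Hy n1y; apply: nle => //; exact: symL.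
(* In an antichain the union of the cosets of [1] and [z] is a module; it contains [1] but not
   [y]. *)
apply: nMz; apply: (sat [set t | H t /\ (L t \/ L (z^-1 * t))]).
- apply: module_inside => [t []//|s m m' Hs nAs].
  have inc t : H t /\ (L t \/ L (z^-1 * t)) -> (s >< t)%O.
    move=> [Ht At]; apply: anti => // Lst; apply: nAs; split=> //.
    have Lts : L (t^-1 * s) by rewrite -[t^-1 * s]invgK invgM invgK; exact: LV.
    case: At => [Lt|Lzt]; [left|right].
      by rewrite -(mulVKg t s); exact: LM.
    by rewrite -(mulVKg t s) mulgA; exact: LM.
  move=> /inc + /inc; rewrite /Order.comparable !negb_or.
  by move=> /andP[/negPf-> /negPf->] /andP[/negPf-> /negPf->].
- by exists 1; split=> //; split=> //; left.
- by move=> /(_ y My)[_ [//|]]; exact: nMcoset'.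
- by split=> //; right; rewrite mulVg.
Qed.

End StrongModules.
End Quotients.

(** * Subgroups of an N-free ordered group *)

Section Main.
Variables (disp : Order.disp_t) (G : orderedGroupType disp).
Hypothesis Nfree : N_free [set: G].
Hypothesis fwG : finite_width ord_le [set: G].
Variables (r : nat) (H : nat -> set G).
Hypothesis H_chain : enumerates_canonical_chain r H.

Lemma chain_dichotomy i : i < r ->
  chain_mod (H i.+1) (H i) \/ antichain_mod (H i.+1) (H i).
Proof.
move=> ir; apply: chain_or_antichain => //.
- exact: (chain_subgroup H_chain).
- exact: (chain_subgroup H_chain (ltnW ir)).
- exact: (chain_strong H_chain).
- exact: (chain_strong H_chain (ltnW ir)).
- by move=> x y; exact: (chain_least_strong_sub H_chain).
Qed.

(** A chain layer of type A would be trivial, against the proper inclusion. Conversely, finite width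
    makes an antichain layer finite. *)
Lemma type_A_antichain_mod i : i < r ->
  type_A (H i.+1) (H i) <-> antichain_mod (H i.+1) (H i).
Proof.
move=> ir; have sub := chain_subset H_chain (leqnSn i) ir.
have sH := chain_subgroup H_chain ir.
have sH' := chain_subgroup H_chain (ltnW ir).
split=> [tA|]; last first.
  by apply: antichain_mod_type_A => //; exact: finite_widthS fwG.
have [ch|//] := chain_dichotomy ir.
by case: (chain_proper H_chain (ltnSn i) ir); exact: chain_mod_type_A.
Qed.

Section Subgroup.
Variable K : set G.
Hypothesis sK : subgroup K.

Lemma subgroup_coset_setI i x y : K x -> K y ->
  ~ (K `&` H i) (x^-1 * y)%g -> ~ H i (x^-1 * y)%g.
Proof.
have /subgroupP[_ KV KM] := sK.
by move=> Kx Ky; apply: contra_not => Hxy; split=> //; apply: KM => //; exact: KV.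
Qed.

Lemma chain_mod_setI i j : chain_mod (H i) (H j) ->
  chain_mod (K `&` H i) (K `&` H j).
Proof.
by move=> ch x y [Kx Hx] [Ky Hy] /(subgroup_coset_setI Kx Ky); exact: ch.
Qed.

Lemma antichain_mod_setI i j : antichain_mod (H i) (H j) ->
  antichain_mod (K `&` H i) (K `&` H j).
Proof.
by move=> an x y [Kx Hx] [Ky Hy] /(subgroup_coset_setI Kx Ky); exact: an.
Qed.

Lemma subgroup_chain_width i : i <= r ->
  has_width ord_le (K `&` H i)
    (\prod_(1 <= j < i.+1 | `[< type_A (H j) (H j.-1) >])
       group_index (K `&` H j) (K `&` H j.-1)).
Proof.
elim: i => [_|i IH ir].
  have [-> _ _ _] := H_chain; have /subgroupP[K1 _ _] := sK.
  rewrite big_geq// (_ : _ `&` _ = [set 1%g]); last first.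
    by apply/seteqP; split=> [z []//|z ->].
  split; first by exists [set 1%g]; [split=> // ? ? -> ->|exact: card_set1].
  by move=> A [A1 _]; rewrite -(card_le_eqr (card_set1 (x := 1%g : G)));
    exact: subset_card_le.
have sub := chain_subset H_chain (leqnSn i) ir.
have sH := subgroupI sK (chain_subgroup H_chain ir).
have sH' := subgroupI sK (chain_subgroup H_chain (ltnW ir)).
have subK : K `&` H i `<=` K `&` H i.+1 by exact: setIS.
have modK : is_module (K `&` H i.+1) (K `&` H i).
  have [modH _ _] := chain_strong H_chain (ltnW ir).
  have := module_setI modH (@subsetT _ (K `&` H i.+1)).
  by rewrite -setIA (setIidr sub).
(* A layer not of type A contributes the factor [1], the width of a chain. *)
rewrite big_mkcond big_nat_recr//= -big_mkcond mulnC.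
apply: (has_width_module sH sH') (IH (ltnW ir)) => //.
have [tA|ntA] := asboolP; last first.
  apply: chain_mod_width => //; apply: chain_mod_setI.
  by have [//|/(type_A_antichain_mod ir)] := chain_dichotomy ir.
apply: antichain_mod_width => //; first exact: finite_widthS fwG.
exact/antichain_mod_setI/type_A_antichain_mod.
Qed.

Lemma subgroup_width : has_width ord_le K
  (\prod_(1 <= j < r.+1 | `[< type_A (H j) (H j.-1) >])
     group_index (K `&` H j) (K `&` H j.-1)).
Proof.
by have := subgroup_chain_width (leqnn r); have [_ -> _ _] := H_chain; rewrite setIT.
Qed.

(** Both elements enter the chain at the same [H i.+1]; by [strong_module_level], the strong module
    of [1] and [k'] contains all of [K ∩ H i.+1], hence [k]. *)
Lemma subgroup_least_strong_module k k' : K k -> k != 1%g -> K k' ->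
  k' != 1%g -> least_strong_module [set: G] 1%g k =
    least_strong_module [set: G] 1%g k' ->
  least_strong_module K 1%g k `<=` least_strong_module K 1%g k'.
Proof.
have /subgroupP[K1 _ _] := sK.
move=> Kk k1 Kk' k'1 e; have GT z : [set: G] z by [].
have [[//|i] ir eS] := chain_least_strong H_chain k1.
have out h : least_strong_module [set: G] 1%g h = H i.+1 -> H i.+1 h /\ ~ H i h.
  move=> eH; have [_ S1h minS] := least_strong_moduleP (GT 1%g) (GT h).
  rewrite -eH; split=> [|Hih]; first by apply: S1h; right.
  apply: (chain_proper H_chain (ltnSn i) ir); rewrite -eH; apply: minS.
    exact: (chain_strong H_chain (ltnW ir)).
  by move=> z [] -> //; exact: (chain1 H_chain (ltnW ir)).
have [Hk _] := out k eS; have [Hk' nHk'] := out k' (etrans (esym e) eS).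
have [strS S1k' _] := least_strong_moduleP K1 Kk'.
have [_ _ minS] := least_strong_moduleP K1 Kk.
apply: minS => // z [] ->; first by apply: S1k'; left.
have [modH _ _] := chain_strong H_chain ir.
have [modH' _ _] := chain_strong H_chain (ltnW ir).
have sH := subgroupI sK (chain_subgroup H_chain ir).
have sH' := subgroupI sK (chain_subgroup H_chain (ltnW ir)).
have sub : K `&` H i `<=` K `&` H i.+1.
  by apply: setIS; exact: (chain_subset H_chain (leqnSn i)).
have di : chain_mod (K `&` H i.+1) (K `&` H i) \/
    antichain_mod (K `&` H i.+1) (K `&` H i).
  have [ch|an] := chain_dichotomy ir; first by left; exact: chain_mod_setI.
  by right; exact: antichain_mod_setI.
apply: (strong_module_level sK sH sH' sub (@subIsetl _ _ _)
  (module_setI modH _) (module_setI modH' _) di strS (y := k')) => //.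
- by apply: S1k'; left.
- by case.
- by apply: S1k'; right.
Qed.

Lemma subgroup_canonical_chain :
  (canonical_chain K #<= canonical_chain [set: G])%card.
Proof.
(* Every member of the chain of [K] must be hit by [f]; by the preceding lemma the choice of [k] is
   immaterial. The default [1] serves members [A] not generated by an element of [K], whose image
   does not matter. *)
pose f A := least_strong_module K 1%g (xget 1%g
  [set k | [/\ K k, k != 1%g & least_strong_module [set: G] 1%g k = A]]).
apply: card_le_trans (card_image_le f (canonical_chain [set: G])).
apply: subset_card_le => _ [k [Kk /eqP k1] <-].
exists (least_strong_module [set: G] 1%g k); first by exists k; split=> //; exact/eqP.
rewrite /f; case: xgetP => [h _ [Kh h1 eh]|/(_ k)[]//].
by apply/seteqP; split; exact: subgroup_least_strong_module.
Qed.

End Subgroup.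

(** The width formulas of [K] and of [G] are compared factor by factor. *)
Lemma subgroup_width_dvd (K : set G) : subgroup K ->
  width ord_le K %| width ord_le [set: G].
Proof.
move=> sK; have sT : subgroup [set: G] by apply/subgroupP; split.
rewrite (has_width_width (subgroup_width sK)) (has_width_width (subgroup_width sT)).
rewrite big_mkcond [X in _ %| X]big_mkcond !big_add1 /= !big_mkord.
apply: (big_ind2 (fun a b => a %| b)) => // [a b c d|i _]; first exact: dvdn_mul.
have ir := ltn_ord i; case: asboolP => // tA.
have sub := chain_subset H_chain (leqnSn i) ir.
have sH := chain_subgroup H_chain ir.
have sH' := chain_subgroup H_chain (ltnW ir).
rewrite !setTI.
(* This is the form [P ∩ L] of [index_dvd], with [K ∩ H i.+1] for [P] and [H i] for [L]. *)
have -> : K `&` H i = (K `&` H i.+1) `&` H i by rewrite -setIA (setIidr sub).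
apply: index_dvd => //; first exact: subgroupI.
  by move=> p l _; exact: (chain_conj H_chain p (ltnW ir)).
by have [] := tA.
Qed.

End Main.

(** By [has_width_module], the width of [K] is that of [K / L] times that of [L]. *)
Lemma quotient_width_dvd (disp : Order.disp_t) (G : orderedGroupType disp)
    (K L : set G) : subgroup K -> subgroup L -> L `<=` K -> is_module K L ->
  finite_width ord_le K ->
  finite_width quotient_le (cosets K L) /\
  width quotient_le (cosets K L) %| width ord_le K.
Proof.
move=> sK sL LK modL fwK; have fwKL := finite_width_cosets sK sL LK fwK.
split=> //; have [m wm] := fwKL; have [n wn] := finite_widthS LK fwK.
by rewrite (has_width_width (has_width_module sK sL LK modL wm wn))
  (has_width_width wm) dvdn_mulr.
Qed.

Theorem corollary8p2 (disp : Order.disp_t) (G : orderedGroupType disp)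
    (G_N_free : N_free [set: G])
    (G_finite_width : finite_width ord_le [set: G])
    (r : nat) (H : nat -> set G)
    (H_chain : enumerates_canonical_chain r H)
    (K : set G) (K_subgroup : subgroup K) :
  [/\ (canonical_chain K #<= canonical_chain [set: G])%card,
      finite_width ord_le K /\
        width ord_le K =
          \prod_(1 <= i < r.+1 | `[< type_A (H i) (H i.-1) >])
             group_index (K `&` H i) (K `&` H i.-1),
      width ord_le K %| width ord_le [set: G] &
      forall L : set G, normal_subgroup K L -> is_module K L ->
        [/\ finite_width quotient_le (cosets K L),
            width quotient_le (cosets K L) %| width ord_le K &
            width ord_le K %| width ord_le [set: G]]].
Proof.
have wK := subgroup_width G_N_free G_finite_width H_chain K_subgroup.
have dvdK := subgroup_width_dvd G_N_free G_finite_width H_chain K_subgroup.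
have fwK : finite_width ord_le K by eexists; exact: wK.
split=> //.
- exact: (subgroup_canonical_chain G_N_free H_chain).
- by split=> //; exact: has_width_width.
- move=> L [sL LK _] modL.
  by have [] := quotient_width_dvd K_subgroup sL LK modL fwK.
Qed.
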